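(* Let $n$ be a positive integer, let $G_1,\ldots,G_n$ be non-trivial groups, and for $2\le i\le n$ let $X_i$ be a set on which $G_i$ acts faithfully. Let $$G^{(n)}:=(\ldots((G_1\wr_{X_2}G_2)\ldots)\wr_{X_{n-1}}G_{n-1})\wr_{X_n}G_n .$$ If $(G_2)_{X_2},\ldots,(G_n)_{X_n}$ are all of torsion-type, set $k:=1$. Otherwise, let $k$ be the largest number in $\{2,\ldots,n\}$ such that $(G_k)_{X_k}$ is not of torsion-type. Then: (i) $G^{(n)}$ is FIG if and only if $G^{(n)}$ is finitely generated and $G_k,\ldots,G_n$ are all FIG. (ii) $G^{(n)}$ is IG if and only if each of $G_k,\ldots,G_n$ is IG or FIG and (i) does not occur, i.e. it is not the case that $G^{(n)}$ is finitely generated and $G_k,\ldots,G_n$ are all FIG. In the case of an iterated regular wreath product (each $X_i=G_i$ with $G_i$ acting by right multiplication), (i) becomes: $G^{(n)}$ is FIG if and only if $G_1,\ldots,G_{k-1}$ are finitely generated and $G_k,\ldots,G_n$ are FIG.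
   Context: A subset $S$ of a group $K$ invariably generates $K$ if for every choice of elements $a_s\in K$ ($s\in S$) one has $\langle a_s^{-1}sa_s : s\in S\rangle=K$. A group is FIG (finitely invariably generated) if it has a finite invariable generating set. A group is IG if it has an invariable generating set but no finite one (so IG excludes FIG). For non-trivial groups $G,H$ with $H$ acting faithfully (on the right) on a set $X$, the (restricted) wreath product is $G\wr_X H=\left(\bigoplus_{x\in X}G_x\right)\rtimes H$, where each $G_x$ is a copy of $G$, $g^{(x)}$ denotes the element $g\in G$ in $G_x$, and $h^{-1}g^{(x)}h=g^{(xh)}$ for $h\in H$. $H_X\le \mathrm{Sym}(X)$ denotes $H$ together with its faithful action on $X$, and $yH_X$ is the orbit of $y\in X$. $H_X$ is of torsion-type if there exists $y\in X$ such that for all $x\in yH_X$ and all $k\in H_X$, the set $x\langle k\rangle$ is finite. $G^{(n)}$ is defined recursively by $G^{(1)}=G_1$ and $G^{(m)}=G^{(m-1)}\wr_{X_m}G_m$. *)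

(* Defs.v *)
From HB Require Import structures.
From mathcomp Require Import all_boot.
From mathcomp Require Import finmap.
From mathcomp Require Import boolp classical_sets functions cardinality.

Set Implicit Arguments.
Unset Strict Implicit.
Unset Printing Implicit Defensive.

Local Open Scope classical_set_scope.
Local Open Scope group_scope.

(* Groups are arbitrary (possibly infinite) [groupType]s.  The choice structure
   carried by [groupType] and [choiceType] is no restriction, since [boolp]
   provides one on every type. *)

Section Generation.
Variable K : groupType.
Implicit Types A S : set K.

Definition nontrivial : Prop := exists g : K, g <> 1.

Definition is_subgroup A : Prop :=
  [/\ A 1, forall x y, A x -> A y -> A (x * y) & forall x, A x -> A x^-1].

Definition subgroup_generated S : set K := smallest is_subgroup S.

Definition finitely_generated : Prop :=
  exists S, finite_set S /\ subgroup_generated S = [set: K].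

(* [s ^ a s] is the conjugate (a s)^-1 * s * (a s). *)
Definition invariably_generates S : Prop :=
  forall a : K -> K, subgroup_generated [set s ^ a s | s in S] = [set: K].

Definition FIG : Prop := exists S, finite_set S /\ invariably_generates S.

Definition IG : Prop := (exists S, invariably_generates S) /\ ~ FIG.

End Generation.

Record right_action (H : groupType) (X : choiceType) := RightAction {
  ract :> X -> H -> X;
  ract1 : forall x, ract x 1 = x;
  ractM : forall x g h, ract x (g * h) = ract (ract x g) h }.

Section Actions.
Variables (H : groupType) (X : choiceType) (act : right_action H X).

Definition faithful_action : Prop :=
  forall h : H, (forall x, act x h = x) -> h = 1.

(* [range (act y)] is the orbit of y under H; [act x @` subgroup_generated [set h]]
   is the orbit of x under the cyclic subgroup <h>. *)
Definition torsion_type : Prop :=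
  exists y : X, forall x, range (act y) x -> forall h : H,
    finite_set (act x @` subgroup_generated [set h]).

Lemma ractK h : cancel (act^~ h) (act^~ h^-1).
Proof. by move=> x /=; rewrite -ractM mulgV ract1. Qed.

Lemma ractKV h : cancel (act^~ h^-1) (act^~ h).
Proof. by move=> x /=; rewrite -ractM mulVg ract1. Qed.

End Actions.

Definition regular_action (G : groupType) : right_action G G :=
  @RightAction G G (fun x g => x * g) (@mulg1 G) (@mulgA G).

(* [Wreath f h], with f finitely supported, stands for the element
   (\prod_x (f x)^(x)) * h.  The relation h^-1 * g^(x) * h = g^(xh) gives
   h * f * h^-1 = (x |-> f (x h)), hence the product [wreath_mul] below.  The
   parameter [act] is a phantom on which the group structure depends. *)
Record wreath (G H : groupType) (X : choiceType) (act : right_action H X) :=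
  Wreath { wbase : {fsfun X -> G with 1}; wtop : H }.

Section Wreath.
Variables (G H : groupType) (X : choiceType) (act : right_action H X).
Local Notation wreath := (@wreath G H X act).
Local Notation Wreath := (@Wreath G H X act).

Lemma wreath_pairK :
  cancel (fun u : wreath => (wbase u, wtop u)) (fun p => Wreath p.1 p.2).
Proof. by case. Qed.

HB.instance Definition _ := Choice.copy wreath (can_type wreath_pairK).

Implicit Types u v w : wreath.

Definition wreath_one : wreath := Wreath [fsfun with 1] 1.

Definition wreath_mul u v : wreath :=
  Wreath
    [fsfun x in (finsupp (wbase u) `|`
                 [fset act x (wtop u)^-1 | x in finsupp (wbase v)])%fset
      => wbase u x * wbase v (act x (wtop u))]
    (wtop u * wtop v).

Definition wreath_inv u : wreath :=
  Wreath
    [fsfun x in [fset act x (wtop u) | x in finsupp (wbase u)]%fset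
      => (wbase u (act x (wtop u)^-1))^-1]
    (wtop u)^-1.

Lemma wreath_mulE u v x :
  wbase (wreath_mul u v) x = wbase u x * wbase v (act x (wtop u)).
Proof.
rewrite fsfunE inE; case: ifPn => //; rewrite negb_or => /andP[ux vx].
rewrite (fsfun_dflt ux) (fsfun_dflt (k := act x (wtop u))) ?mulg1//.
apply: contra vx => vx; apply/imfsetP; exists (act x (wtop u)) => //.
by rewrite ractK.
Qed.

Lemma wreath_invE u x :
  wbase (wreath_inv u) x = (wbase u (act x (wtop u)^-1))^-1.
Proof.
rewrite fsfunE; case: ifPn => // ux.
rewrite (fsfun_dflt (k := act x (wtop u)^-1)) ?invg1//.
apply: contra ux => ux; apply/imfsetP; exists (act x (wtop u)^-1) => //.
by rewrite ractKV.
Qed.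

Lemma wreath_eqP u v : wbase u =1 wbase v -> wtop u = wtop v -> u = v.
Proof. by case: u v => [f h] [g k] /= /fsfunP -> ->. Qed.

Lemma wreath_mulA : associative wreath_mul.
Proof.
move=> u v w; apply: wreath_eqP => [x|]; last exact: mulgA.
by rewrite !wreath_mulE /= ractM mulgA.
Qed.

Lemma wreath_mul1 : left_id wreath_one wreath_mul.
Proof.
move=> u; apply: wreath_eqP => [x|]; last exact: mul1g.
by rewrite wreath_mulE /= fsfunE mul1g ract1.
Qed.

Lemma wreath_mulr1 : right_id wreath_one wreath_mul.
Proof.
move=> u; apply: wreath_eqP => [x|]; last exact: mulg1.
by rewrite wreath_mulE /= fsfunE mulg1.
Qed.

Lemma wreath_mulV : left_inverse wreath_one wreath_inv wreath_mul.
Proof.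
move=> u; apply: wreath_eqP => [x|]; last exact: mulVg.
by rewrite wreath_mulE wreath_invE /= fsfunE mulVg.
Qed.

Lemma wreath_mulrV : right_inverse wreath_one wreath_inv wreath_mul.
Proof.
move=> u; apply: wreath_eqP => [x|]; last exact: mulgV.
by rewrite wreath_mulE wreath_invE /= fsfunE ractK mulgV.
Qed.

HB.instance Definition _ := isGroup.Build wreath wreath_mulA wreath_mul1
  wreath_mulr1 wreath_mulV wreath_mulrV.

(* g^(x), the copy of g in the x-th factor *)
Definition wreath_base (x : X) (g : G) : wreath :=
  Wreath [fsfun y in [fset x]%fset => g] 1.

Definition wreath_top (h : H) : wreath := Wreath [fsfun with 1] h.

Lemma wreath_baseE x g y : wbase (wreath_base x g) y = if y == x then g else 1.
Proof. by rewrite fsfunE inE. Qed.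

(* The defining relation h^-1 * g^(x) * h = g^(xh). *)
Lemma wreath_baseJ x g h :
  wreath_base x g ^ wreath_top h = wreath_base (act x h) g.
Proof.
apply: wreath_eqP => [y|]; last by rewrite /= mul1g mulVg.
rewrite !wreath_mulE wreath_invE wreath_baseE /= !fsfunE invg1 mul1g mulg1.
rewrite inE (_ : (act y h^-1 == x) = (y == act x h)) //.
by apply/eqP/eqP => [<-|->]; rewrite ?ractKV ?ractK.
Qed.

End Wreath.

Arguments wreath G {H X} act.

(* The groups G_1, ..., G_n are the values at 1, ..., n of a family indexed by
   nat, and similarly for the sets X_2, ..., X_n and the actions; the other
   values of these families are irrelevant.  For n >= 1,
   [iterated_wreath act n] is G^(n). *)
Fixpoint iterated_wreath (G : nat -> groupType) (X : nat -> choiceType)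
    (act : forall i, right_action (G i) (X i)) (n : nat) : groupType :=
  match n with
  | (m.+1 as m').+1 =>
      wreath (iterated_wreath act m') (act m'.+1)
  | _ => G 1%N
  end.

(* k is the largest index in {2, ..., n} whose action is not of torsion-type,
   and k = 1 if there is none. *)
Definition last_non_torsion (G : nat -> groupType) (X : nat -> choiceType)
    (act : forall i, right_action (G i) (X i)) (n k : nat) : Prop :=
  (k = 1%N /\ forall i, (2 <= i <= n)%N -> torsion_type (act i)) \/
  [/\ (2 <= k <= n)%N, ~ torsion_type (act k) &
      forall i, (k < i <= n)%N -> torsion_type (act i)].

Definition regular_wreath (G : nat -> groupType) (n : nat) : groupType :=
  iterated_wreath (fun i => regular_action (G i)) n.

(* Main.v *)
Require Import Defs.
From mathcomp Require Import all_boot finmap.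
From mathcomp Require Import zify.
From mathcomp Require Import boolp classical_sets functions cardinality.

Set Implicit Arguments.
Unset Strict Implicit.
Unset Printing Implicit Defensive.

(** A set S invariably generates K if and only if no proper subgroup of K
    meets the conjugacy class of every element of S.  The theorem follows, by
    induction on the number of factors, from a criterion for a single wreath
    product W of G by H, acting on X: W has an invariable generating set if
    and only if H has one and, when the action is of torsion-type, G has one
    too ([invariably_generated_wreath]); and W is FIG if and only if W is
    finitely generated, H is FIG and, when the action is of torsion-type, G is
    FIG ([FIG_wreath]).  A group is IG or FIG exactly when it has an
    invariable generating set, so the two equivalences give the statements
    about FIG and about IG.

    H is a quotient of W, which gives one condition.  Suppose that all cyclic
    subgroups of H have finite orbits on the orbit of y.  The conjugacy class
    of an element of W with top component h is then governed, on that orbit,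
    by the products of its coordinates along the cycles of h: if a subgroup M
    of G meets the classes of these cycle products, then all the coordinates
    at once can be conjugated into M ([conjugate_into_subgroup]).  So the
    cycle products of an invariable generating set of W invariably generate G.

    Conversely let L be a subgroup of W that meets the conjugacy classes of
    the proposed generators, which include lifts of an invariable generating
    set of H.  It surjects onto H, so that conjugating elements may be taken
    in the base, and L contains the base as soon as it contains one factor G_x
    for x in each orbit.  If G has an invariable generating set, then placing
    it at x suffices.  If instead k in H has an infinite cycle through x, then
    any generating set A of G will do.  Indeed let L contain k and conjugates,
    by base elements, of g^(x) and of g^(x) k for g in A.  The conjugating
    element b of g^(x) k is trivial far out on the infinite cycle, in both
    directions, and this forces g to be the value at x of some element of the
    intersection of L with the base.  The intersection of L with G_x is
    normalised by all these values, hence normal in G_x, and it meets the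
    class of every g in A: it is G_x ([subgroup_factor_full]).  Finite
    generation of W provides finite sets of base points and of generators of
    G. *)

(** * Invariable generation *)

Section Generation.
Local Open Scope classical_set_scope.
Local Open Scope group_scope.
Variable K : groupType.
Implicit Types (L S : set K).

Definition meets_classes S L : Prop := forall s, S s -> exists a, L (s ^ a).

Definition invariably_generated : Prop := exists S, invariably_generates S.

Lemma subgroup_generated_subgroup S : is_subgroup (subgroup_generated S).
Proof.
split=> [A [[] //]|x y Sx Sy A SA|x Sx A SA].
- by case: (SA) => [[_ AM _] _]; apply: AM; [apply: Sx|apply: Sy].
- by case: (SA) => [[_ _ AV] _]; apply: AV; apply: Sx.
Qed.

Lemma subgroup_generated_sub S : S `<=` subgroup_generated S.
Proof. by move=> x Sx A [_]; apply. Qed.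

Lemma subgroup_generated_fullP S :
  subgroup_generated S = [set: K] <->
  forall L, is_subgroup L -> S `<=` L -> forall x, L x.
Proof.
split=> [genS L subL SL x|genS].
  have Sx : subgroup_generated S x by rewrite genS.
  exact: Sx.
apply/seteqP; split=> // x _.
exact: genS _ (subgroup_generated_subgroup S) (@subgroup_generated_sub S) x.
Qed.

Lemma invariably_generatesP S :
  invariably_generates S <->
  forall L, is_subgroup L -> meets_classes S L -> forall x, L x.
Proof.
split=> [genS L subL SL|genS a].
  have /choice[a La] : forall s, exists a, S s -> L (s ^ a).
    move=> s; have [/SL[a La]|] := pselect (S s); first by exists a.
    by exists 1.
  apply: ((subgroup_generated_fullP _).1 (genS a)) => // _ [s Ss <-].
  exact: La.
apply/subgroup_generated_fullP => L subL SL; apply: genS => // s Ss.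
by exists (a s); apply: SL; exists s.
Qed.

Lemma invariably_generates_gen S :
  invariably_generates S -> subgroup_generated S = [set: K].
Proof.
move=> /(_ (fun=> 1)) <-; congr subgroup_generated; apply/seteqP.
by split=> [x Sx|_ [x Sx <-]]; rewrite ?conjg1//; exists x; rewrite ?conjg1.
Qed.

Lemma FIG_finitely_generated : FIG K -> finitely_generated K.
Proof. by case=> S [finS /invariably_generates_gen]; exists S. Qed.

(** [IG] excludes [FIG], so that the two together say only that there is an
    invariable generating set, finite or not. *)
Lemma IG_or_FIG : IG K \/ FIG K <-> invariably_generated.
Proof.
split=> [[[]|[S []]]|]; [by []|by exists S|move=> igK].
by have [|nfig] := pselect (FIG K); [right|left].
Qed.

Section Subgroup.
Variable L : set K.
Hypothesis subL : is_subgroup L.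

Lemma subg1 : L 1. Proof. by case: subL. Qed.
Lemma subgM x y : L x -> L y -> L (x * y).
Proof. by case: subL => _ + _; apply. Qed.
Lemma subgV x : L x -> L x^-1. Proof. by case: subL => _ _; apply. Qed.
Lemma subgJ x y : L x -> L y -> L (x ^ y).
Proof.
by move=> Lx Ly; rewrite conjgE; do !apply: subgM => //; apply: subgV.
Qed.
Lemma subgX x n : L x -> L (x ^+ n).
Proof.
move=> Lx; elim: n => [|n IHn]; first by rewrite expg0; apply: subg1.
by rewrite expgS; apply: subgM.
Qed.

Lemma subgroup_conj a : is_subgroup [set x | L (x ^ a)].
Proof.
split=> [|x y|x] /=; first by rewrite conj1g; apply: subg1.
  by rewrite conjMg; apply: subgM.
by rewrite conjVg; apply: subgV.
Qed.

(** Used along an infinite cycle, where [c] lists the coordinates of a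
    finitely supported function, so that it is eventually trivial: the trivial
    value is carried back to the index 0 through the quotients. *)
Lemma subgroup_sequence (c : nat -> K) m :
  c m = 1 -> (forall i, L ((c i)^-1 * c i.+1)) -> L (c 0%N).
Proof.
elim: m c => [|m IHm] c cm Lc; first by rewrite cm; apply: subg1.
have -> : c 0%N = ((c 0%N)^-1 * c 1%N * (c 1%N)^-1)^-1.
  by rewrite mulgK invgK.
apply/subgV/subgM => //; apply/subgV.
by apply: IHm (fun i => c i.+1) _ _.
Qed.
End Subgroup.
End Generation.

Section Morphism.
Local Open Scope classical_set_scope.
Local Open Scope group_scope.
Variables (K K' : groupType) (f : K -> K').
Hypothesis fM : {morph f : x y / x * y}.
Hypothesis f_surj : forall y, exists x, f x = y.

Let f1 : f 1 = 1.
Proof. by apply: (@mulgI _ (f 1)); rewrite -fM !mulg1. Qed.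

Let fV x : f x^-1 = (f x)^-1.
Proof. by apply: (@mulgI _ (f x)); rewrite -fM !mulgV f1. Qed.

Lemma subgroup_preimage (L : set K') : is_subgroup L -> is_subgroup (f @^-1` L).
Proof.
move=> subL; split=> [|x y|x]; rewrite /preimage /= ?f1 ?fM ?fV.
- exact: subg1.
- exact: subgM.
- exact: subgV.
Qed.

Lemma subgroup_image (L : set K) : is_subgroup L -> is_subgroup (f @` L).
Proof.
move=> subL; split=> [|_ _ [x Lx <-] [y Ly <-]|_ [x Lx <-]].
- by exists 1 => //; apply: subg1.
- by exists (x * y) => //; apply: subgM.
- by exists x^-1 => //; apply: subgV.
Qed.

Lemma invariably_generates_image S :
  invariably_generates S -> invariably_generates (f @` S).
Proof.
move/invariably_generatesP => genS; apply/invariably_generatesP => L subL SL y.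
have [x <-] := f_surj y; apply: (genS _ (subgroup_preimage subL)) => s Ss.
have [|a] := SL (f s); first by exists s.
have [b <-] := f_surj a => Lsb; exists b.
by rewrite /preimage /= conjgE !fM fV -conjgE.
Qed.

Lemma finitely_generated_image : finitely_generated K -> finitely_generated K'.
Proof.
case=> S [finS /subgroup_generated_fullP genS]; exists (f @` S).
split; first exact: finite_image.
apply/subgroup_generated_fullP => L subL SL y; have [x <-] := f_surj y.
by apply: (genS _ (subgroup_preimage subL)) => s Ss; apply: SL; exists s.
Qed.
End Morphism.

(** * Orbits of cyclic groups *)

Section CyclicOrbits.
Local Open Scope classical_set_scope.
Local Open Scope group_scope.
Variables (H : groupType) (X : choiceType) (act : right_action H X).

Lemma ract_inj h : injective (act^~ h).
Proof. exact: can_inj (ractK act h). Qed.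

Lemma subgroup_generatedX (h : H) i : subgroup_generated [set h] (h ^+ i).
Proof.
apply: (subgX (subgroup_generated_subgroup _)).
exact: subgroup_generated_sub.
Qed.

Lemma ractX_inj x h :
  (forall m, act x (h ^+ m.+1) <> x) -> injective (fun i => act x (h ^+ i)).
Proof.
move=> noper.
have inj i j : i <= j -> act x (h ^+ i) = act x (h ^+ j) -> i = j.
  move=> ij; rewrite -(subnK ij) expgnDr ractM => /ract_inj.
  by case: (j - i)%N => // m xm; case: (noper m).
move=> i j /= eqij.
by have [/inj->|/ltnW/inj->] := leqP i j.
Qed.

Lemma cyclic_orbit_finiteP x h :
  finite_set (act x @` subgroup_generated [set h]) <->
  exists m, act x (h ^+ m.+1) = x.
Proof.
split=> [finx|[m xm]].
  apply: contrapT => noper; apply: infinite_nat.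
  have inj : injective (fun i => act x (h ^+ i)).
    by apply: ractX_inj => m xm; apply: noper; exists m.
  apply: sub_finite_set (finite_preimage (fun i j _ _ => @inj i j) finx) => i _.
  by exists (h ^+ i) => //; apply: subgroup_generatedX.
(* The forward iterates of a periodic point are stable under h and its
   inverse. *)
pose O : set X := (fun i => act x (h ^+ i)) @` `I_m.+1.
have Oh z : O z -> O (act z h).
  move=> [i /= ltim <-]; rewrite -ractM -expgSr.
  have [ltim1|] := ltnP i m; first by exists i.+1.
  move=> ?; exists 0%N; rewrite //= ract1 -[LHS]xm.
  by congr (act x (h ^+ _)); lia.
have OhV z : O z -> O (act z h^-1).
  move=> [[|i] /= ltim <-].
    by exists m; rewrite //= ract1 -[in RHS]xm expgSr ractM ractK.
  by exists i; rewrite ?expgSr ?ractM ?ractK//= ltnW.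
pose P : set H := [set g | forall z, O z -> O (act z g) /\ O (act z g^-1)].
have subP : is_subgroup P.
  split=> [z|g k Pg Pk z|g Pg z] /=; first by rewrite invg1 ract1.
    move=> Oz; rewrite invgM !ractM.
    by have [[/Pk[? _] _] [_ /Pg[]]] := (Pg _ Oz, Pk _ Oz).
  by move=> /Pg[]; rewrite invgK.
apply: (@sub_finite_set _ _ O) (finite_image _ (finite_II m.+1)) => _ [g hg <-].
have Pg : P g.
  apply: hg; split=> // _ -> z Oz.
  by split; [apply: Oh|apply: OhV].
by have /Pg[] : O x by exists 0%N; rewrite // expg0 ract1.
Qed.
End CyclicOrbits.

(** * Wreath products and their subgroups *)

Section WreathTheory.
Local Open Scope classical_set_scope.
Local Open Scope group_scope.
Variables (G H : groupType) (X : choiceType) (act : right_action H X).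
Local Notation W := (wreath G act).
Local Notation base := (@wreath_base G H X act).
Local Notation top := (@wreath_top G H X act).
Implicit Types (u v w : W) (L : set W).

Lemma wtopM u v : wtop (u * v) = wtop u * wtop v. Proof. by []. Qed.
Lemma wtopV u : wtop u^-1 = (wtop u)^-1. Proof. by []. Qed.
Lemma wtopJ u v : wtop (u ^ v) = wtop u ^ wtop v.
Proof. by rewrite !conjgE. Qed.
Lemma wtopX u i : wtop (u ^+ i) = wtop u ^+ i.
Proof. by elim: i => // i IHi; rewrite !expgS wtopM IHi. Qed.
Lemma wtop_surj h : exists u, wtop u = h.
Proof. by exists (top h). Qed.

Lemma wbaseM u v x : wbase (u * v) x = wbase u x * wbase v (act x (wtop u)).
Proof. exact: wreath_mulE. Qed.
Lemma wbaseV u x : wbase u^-1 x = (wbase u (act x (wtop u)^-1))^-1.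
Proof. exact: wreath_invE. Qed.
Lemma wbase1 x : wbase (1 : W) x = 1. Proof. by rewrite fsfunE. Qed.
Lemma wbase_top h x : wbase (top h) x = 1. Proof. by rewrite fsfunE. Qed.
Lemma wbaseXS u i x :
  wbase (u ^+ i.+1) x = wbase (u ^+ i) x * wbase u (act x (wtop u ^+ i)).
Proof. by rewrite expgSr wbaseM wtopX. Qed.

Lemma wreath_eq u v : wbase u =1 wbase v -> wtop u = wtop v -> u = v.
Proof. exact: wreath_eqP. Qed.

Lemma wreath_base1 x : base x 1 = 1.
Proof.
by apply: wreath_eq => // y; rewrite wreath_baseE wbase1; case: ifP.
Qed.

Lemma wreath_baseM x : {morph base x : g h / g * h}.
Proof.
move=> g h; apply: wreath_eq => [y|]; last by rewrite wtopM mulg1.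
by rewrite wbaseM ract1 !wreath_baseE; case: ifP; rewrite ?mulg1.
Qed.

Lemma wreath_base_conj x g u :
  base x g ^ u = base (act x (wtop u)) (g ^ wbase u x).
Proof.
apply: wreath_eq => [y|]; last by rewrite wtopJ conj1g.
rewrite conjgE !wbaseM wbaseV ract1 !wreath_baseE.
rewrite (_ : (y == _) = (act y (wtop u)^-1 == x)); last first.
  by apply/eqP/eqP => [->|<-]; rewrite ?ractKV ?ractK.
by case: eqP => [->|_]; rewrite ?conjgE // mul1g mulVg.
Qed.

(** [L] surjects onto the top group, that is, the base and [L] together
    generate the wreath product. *)
Definition covers_top L : Prop := forall h, exists2 u, L u & wtop u = h.

Lemma meets_classes_covers_top T L : invariably_generates T ->
  is_subgroup L -> meets_classes (top @` T) L -> covers_top L.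
Proof.
move=> /invariably_generatesP genT subL TL h.
have [|u Lu <-] := genT _ (subgroup_image wtopM subL) _ h; last by exists u.
move=> t Tt; have [|a La] := TL (top t); first by exists t.
by exists (wtop a), (top t ^ a); rewrite ?wtopJ.
Qed.

(** The conjugating element is a base element times an element of [L], and the
    second factor can be dropped. *)
Lemma meets_class_base_conj L w : is_subgroup L -> covers_top L ->
  (exists a, L (w ^ a)) -> exists2 b, wtop b = 1 & L (w ^ b).
Proof.
move=> subL coverL [a La]; have [l Ll la] := coverL (wtop a).
exists (a * l^-1); first by rewrite wtopM wtopV la mulgV.
by rewrite conjgM; apply: subgJ => //; apply: subgV.
Qed.

Lemma subgroup_factor L x : is_subgroup L -> is_subgroup [set g | L (base x g)].
Proof. by move=> subL; apply: subgroup_preimage subL; apply: wreath_baseM. Qed.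

Lemma subgroup_full_base L : is_subgroup L -> covers_top L ->
  (forall x g, L (base x g)) -> forall w, L w.
Proof.
move=> subL coverL Lbase w.
suff Lb (s : seq X) u :
    wtop u = 1 -> (forall x, x \notin s -> wbase u x = 1) -> L u.
  have [l Ll lw] := coverL (wtop w); rewrite -[w](mulgVK l).
  apply: subgM => //; apply: (Lb (finsupp (wbase (w * l^-1)))).
    by rewrite wtopM wtopV lw mulgV.
  by move=> x; apply: fsfun_dflt.
(* The coordinates in the support are split off one at a time. *)
elim: s u => [|x s IHs] u u1 us.
  suff -> : u = 1 by apply: subg1.
  by apply: wreath_eq => [y|//]; rewrite us ?wbase1.
rewrite -[u](mulVKg (base x (wbase u x))); apply: subgM => //.
have wbE y : wbase ((base x (wbase u x))^-1 * u) y =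
    if y == x then 1 else wbase u y.
  rewrite wbaseM wbaseV wtopV invg1 !ract1 wreath_baseE.
  by case: eqP => [->|_]; rewrite ?mulVg ?invg1 ?mul1g.
apply: IHs => [|y]; first by rewrite wtopM wtopV u1 invg1 mulg1.
by rewrite wbE; case: eqP => // /eqP yx ys; apply: us; rewrite inE negb_or yx.
Qed.

(** Conjugation by an element of [L] above h maps the factor at z onto the
    factor at z h, so one point of each orbit is enough.  The restriction to
    non-trivial g makes the condition on [Z] hold for the supports of a
    generating set, even when [G] is trivial. *)
Lemma subgroup_full_factors L (Z : set X) : is_subgroup L -> covers_top L ->
  (forall x (g : G), g <> 1 -> exists2 z, Z z & range (act z) x) ->
  (forall z g, Z z -> L (base z g)) -> forall w, L w.
Proof.
move=> subL coverL Zorb LZ; apply: subgroup_full_base => // x g.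
have [->|/(Zorb x)[z Zz [h _ <-]]] := pselect (g = 1).
  by rewrite wreath_base1; apply: subg1.
have [u Lu <-] := coverL h.
have -> : base (act z (wtop u)) g = base z (g ^ (wbase u z)^-1) ^ u.
  by rewrite wreath_base_conj conjgKV.
by apply: subgJ => //; apply: LZ.
Qed.

Lemma invariably_generates_wreath T A Z :
  invariably_generates T -> invariably_generates A ->
  (forall x (g : G), g <> 1 -> exists2 z, Z z & range (act z) x) ->
  invariably_generates (top @` T `|` [set base z g | z in Z & g in A]).
Proof.
move=> genT /invariably_generatesP genA Zorb.
apply/invariably_generatesP => L subL SL.
have coverL : covers_top L.
  by apply: (meets_classes_covers_top genT) => // s Ts; apply: SL; left.
apply: (subgroup_full_factors (Z := Z)) => // z g Zz.
apply: (genA _ (subgroup_factor z subL)) => {}g Ag.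
have [|b b1] := @meets_class_base_conj L (base z g) subL coverL.
  by apply: SL; right; exists z => //; exists g.
by rewrite wreath_base_conj b1 ract1; exists (wbase b z).
Qed.

Lemma wreath_topM : {morph top : h k / h * k}.
Proof.
by move=> h k; apply: wreath_eq => // x; rewrite wbaseM !wbase_top mulg1.
Qed.

Lemma wbase_eventually1 u (f : nat -> X) :
  injective f -> exists m, wbase u (f m) = 1.
Proof.
move=> inj; apply: contrapT => no1; apply: infinite_nat.
have finu := finite_fset (finsupp (wbase u)).
apply: sub_finite_set (finite_preimage (fun i j _ _ => @inj i j) finu) => i _.
by rewrite /preimage /= mem_finsupp; apply/eqP => ui; apply: no1; exists i.
Qed.

(** The case of an infinite cycle.  [N] below consists of the values at x of
    the base elements of [L].  As [L] contains the powers of k, the values of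
    these elements at every point of the cycle of x lie in [N] too.
    For g in [A] the commutator-like element d = (g^(x) k)^b k^-1 of [L] has
    value b(z)^-1 b(z k) at a point z other than x, and b(x)^-1 g b(x k) at x.
    As b is finitely supported, going inwards from the two ends of the cycle
    shows that b(x k) and b(x) lie in [N], hence so does g. *)
Lemma subgroup_factor_full L A x k :
  is_subgroup L -> covers_top L -> subgroup_generated A = [set: G] ->
  (forall m, act x (k ^+ m.+1) <> x) -> L (top k) ->
  (forall g, A g -> exists2 b, wtop b = 1 & L (base x g ^ b)) ->
  (forall g, A g -> exists2 b, wtop b = 1 & L ((base x g * top k) ^ b)) ->
  forall g, L (base x g).
Proof.
move=> subL coverL /subgroup_generated_fullP genA noper Lk LA LAk.
pose N : set G := [set wbase u x | u in [set u | L u /\ wtop u = 1]].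
have subN : is_subgroup N.
  split=> [|_ _ [u [Lu u1] <-] [v [Lv v1] <-]|_ [u [Lu u1] <-]].
  - by exists 1; rewrite ?wbase1//; split=> //; apply: subg1.
  - exists (u * v); last by rewrite wbaseM u1 ract1.
    by split; [apply: subgM|rewrite wtopM u1 v1 mulg1].
  - exists u^-1; last by rewrite wbaseV u1 invg1 ract1.
    by split; [apply: subgV|rewrite wtopV u1 invg1].
have subK := subgroup_preimage wreath_topM subL.
have LX i : L (top (k ^+ i)) by exact: (subgX subK i Lk).
have LVX i : L (top (k^-1 ^+ i)) by exact: (subgX subK i (subgV subK Lk)).
have NL d h : L d -> wtop d = 1 -> L (top h) -> N (wbase d (act x h)).
  move=> Ld d1 Lh; exists (d ^ (top h)^-1); first split.
  - by apply: subgJ => //; apply: subgV.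
  - by rewrite wtopJ d1 conj1g.
  rewrite conjgE invgK !wbaseM wbase_top mul1g.
  by rewrite wbaseV wbase_top invg1 mulg1.
have Nfull : forall g, N g.
  apply: genA => // g /LAk[b b1 Lb].
  pose d := (base x g * top k) ^ b * (top k)^-1.
  have Ld : L d by apply: subgM => //; apply: subgV.
  have d1 : wtop d = 1 by rewrite wtopM wtopJ b1 conjg1 wtopM mul1g mulgV.
  have dE y : wbase d y =
      (wbase b y)^-1 * ((if y == x then g else 1) * wbase b (act y k)).
    rewrite wbaseM wbaseV wbase_top invg1 mulg1 conjgE !wbaseM wbaseV wbase_top.
    by rewrite wreath_baseE wtopV wtopM /= b1 !invg1 !ract1 mulg1 mul1g.
  have Nbk : N (wbase b (act x k)).
    pose c i := wbase b (act x (k ^+ i.+1)).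
    have [|m cm] := @wbase_eventually1 b (fun i => act x (k ^+ i.+1)).
      by move=> i j /(ractX_inj noper)[].
    rewrite -[k]expg1; apply: (subgroup_sequence subN (c := c) cm) => i.
    have -> : (c i)^-1 * c i.+1 = wbase d (act x (k ^+ i.+1)).
      by rewrite dE; case: eqP => [/noper//|_]; rewrite mul1g -ractM -expgSr.
    exact: NL.
  have Nb : N (wbase b x).
    have noperV m : act x (k^-1 ^+ m.+1) <> x.
      rewrite expVgn => /(congr1 (act^~ (k ^+ m.+1))).
      by rewrite /= ractKV => /esym/noper.
    pose c i := wbase b (act x (k^-1 ^+ i)).
    have [m cm] := @wbase_eventually1 b _ (ractX_inj noperV).
    suff : N (c 0%N) by rewrite /c ract1.
    apply: (subgroup_sequence subN (c := c) cm) => i.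
    have -> : (c i)^-1 * c i.+1 = (wbase d (act x (k^-1 ^+ i.+1)))^-1.
      rewrite dE; case: eqP => [/noperV//|_].
      by rewrite mul1g -ractM expgSr mulgVK invgM invgK -expgSr.
    by apply: subgV => //; apply: NL.
  (* Here the value of d at x itself is used. *)
  have -> : g = wbase b x * wbase d x * (wbase b (act x k))^-1.
    by rewrite dE eqxx mulVKg mulgK.
  apply: subgM => //; last exact: subgV.
  apply: subgM => //; rewrite -[X in wbase d X](ract1 act).
  by apply: NL => //; apply: (subg1 subK).
(* The intersection of L with the factor at x is now normal in that factor:
   the conjugation by b(x) is undone by an element of L with value b(x)^-1 at
   x. *)
apply: genA; first exact: subgroup_factor.
move=> g /LA[b b1 Lb] /=; have [u [Lu u1] ub] := Nfull (wbase b x)^-1.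
have -> : base x g = (base x g ^ b) ^ u.
  by rewrite !wreath_base_conj b1 ract1 ub conjgK u1 ract1.
exact: subgJ.
Qed.

(** For each pair (x, k) in [Q], the orbit of x under k is infinite.  A
    conjugate of [L] contains k itself, and then contains the whole factor at
    x; conjugation by a base element preserves this factor. *)
Lemma invariably_generates_wreath_infinite T A (Q : set (X * H)) :
  invariably_generates T -> (Q !=set0 -> subgroup_generated A = [set: G]) ->
  (forall x (g : G), g <> 1 -> exists2 q, Q q & range (act q.1) x) ->
  (forall q, Q q -> forall m, act q.1 (q.2 ^+ m.+1) <> q.1) ->
  invariably_generates
    (top @` (T `|` snd @` Q) `|` [set base q.1 g | q in Q & g in A] `|`
     [set base q.1 g * top q.2 | q in Q & g in A]).
Proof.
move=> genT genA Qorb noper; apply/invariably_generatesP => L subL SL.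
have coverL : covers_top L.
  apply: (meets_classes_covers_top genT) => // _ [t Tt <-]; apply: SL.
  by left; left; exists t => //; left.
apply: (subgroup_full_factors (Z := fst @` Q)) => //.
  by move=> x g /(Qorb x)[q Qq qx]; exists q.1 => //; exists q.
move=> _ g' [[x k] Qq <-] /=; move: g'.
have {}genA : subgroup_generated A = [set: G] by apply: genA; exists (x, k).
have [|b b1 Lb] := @meets_class_base_conj L (top k) subL coverL.
  by apply: SL; left; left; exists k => //; right; exists (x, k).
pose L' : set W := [set w | L (w ^ b)].
have subL' : is_subgroup L' by apply: subgroup_conj.
have coverL' : covers_top L'.
  move=> h; have [u Lu uh] := coverL h; exists (u ^ b^-1).
    by rewrite /L' /= conjgKV.
  by rewrite wtopJ wtopV b1 invg1 conjg1.
have meetL' w : (exists a, L (w ^ a)) -> exists2 c, wtop c = 1 & L' (w ^ c).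
  move=> [a La]; apply: meets_class_base_conj => //; exists (a * b^-1).
  by rewrite /L' /= conjgM conjgKV.
have L'x : forall g, L' (base x g).
  apply: (subgroup_factor_full subL' coverL' genA (noper _ Qq)) => // g Ag.
    by apply/meetL'/SL; left; right; exists (x, k) => //; exists g.
  by apply/meetL'/SL; right; exists (x, k) => //; exists g.
move=> g; have := L'x (g ^ (wbase b x)^-1).
by rewrite /L' /= wreath_base_conj b1 ract1 conjgKV.
Qed.

(** The supports of finitely many generators meet finitely many orbits, and
    the supports of their products lie in these orbits. *)
Lemma finitely_generated_wreath_orbits : finitely_generated W ->
  exists Z : set X, finite_set Z /\
    forall x (g : G), g <> 1 -> exists2 z, Z z & range (act z) x.
Proof.
case=> S [finS /subgroup_generated_fullP genS].
exists (\bigcup_(s in S) [set` finsupp (wbase s)]).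
split; first by apply: bigcup_finite => // s _; apply: finite_fset.
set Z := \bigcup_(s in S) _.
pose L : set W :=
  [set w | forall x, wbase w x <> 1 -> exists2 z, Z z & range (act z) x].
have Lfull : forall w, L w.
  apply: genS => [|s Ss x /eqP sx]; last first.
    exists x; last by exists 1; rewrite ?ract1.
    by exists s; rewrite //= mem_finsupp.
  have shift x h z : range (act z) (act x h) -> range (act z) x.
    by move=> [k _ kx]; exists (k * h^-1); rewrite // ractM kx ractK.
  split=> [x|u v Lu Lv x|u Lu x]; first by rewrite wbase1.
    have [u1|/Lu//] := pselect (wbase u x = 1).
    by rewrite wbaseM u1 mul1g => /Lv[z Zz /shift xz]; exists z.
  rewrite wbaseV => u1; have [|z Zz /shift xz] := Lu (act x (wtop u)^-1).
    by move=> ux; apply: u1; rewrite ux invg1.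
  by exists z.
by move=> x g g1; apply: (Lfull (base x g)); rewrite wreath_baseE eqxx.
Qed.

(** The coordinates of finitely many generators generate [G]; the point [y] is
    needed since [G] does not appear in the wreath product over an empty
    set. *)
Lemma finitely_generated_wreath_bottom (y : X) :
  finitely_generated W -> finitely_generated G.
Proof.
case=> S [finS /subgroup_generated_fullP genS].
pose A : set G := \bigcup_(s in S) (wbase s @` [set` finsupp (wbase s)]).
exists A; split.
  by apply: bigcup_finite => // s _; apply/finite_image/finite_fset.
apply/seteqP; split=> // g _.
have subA := subgroup_generated_subgroup A.
pose L : set W := [set w | forall x, subgroup_generated A (wbase w x)].
have Lfull : forall w, L w.
  apply: genS => [|s Ss x].
    split=> [x|u v Lu Lv x|u Lu x]; rewrite ?wbase1 ?wbaseM ?wbaseV.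
    - exact: (subg1 subA).
    - exact: (subgM subA).
    - exact: (subgV subA).
  have [xs|/fsfun_dflt->] := boolP (x \in finsupp (wbase s)).
    by apply: subgroup_generated_sub; exists s => //; exists x.
  exact: (subg1 subA).
by have := Lfull (base y g) y; rewrite wreath_baseE eqxx.
Qed.

Lemma finitely_generated_wreath (Z : set X) : finite_set Z ->
  (forall x (g : G), g <> 1 -> exists2 z, Z z & range (act z) x) ->
  finitely_generated G -> finitely_generated H -> finitely_generated W.
Proof.
move=> finZ Zorb [A [finA /subgroup_generated_fullP genA]].
case=> T [finT /subgroup_generated_fullP genT].
exists (top @` T `|` [set base z g | z in Z & g in A]); split.
  by rewrite finite_setU; split; [apply: finite_image|apply: finite_image2].
apply/subgroup_generated_fullP => L subL SL.
apply: (subgroup_full_factors subL _ Zorb) => [h|z g Zz].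
  exists (top h) => //; move: h.
  apply: genT; first exact: subgroup_preimage wreath_topM _ subL.
  by move=> t Tt; apply: SL; left; exists t.
move: g; apply: genA; first exact: subgroup_factor.
by move=> g Ag; apply: SL; right; exists z => //; exists g.
Qed.

End WreathTheory.

(** * Cycle products *)

(** The least element of a decidable set of natural numbers, and 0 for the
    empty set: unlike [ex_minn] it takes no existence proof, so that it can be
    used to define a function of points whose orbits may be infinite. *)
Definition least (P : pred nat) : nat :=
  if pselect (exists m, P m) is left exP then ex_minn exP else 0.

Lemma leastP (P : pred nat) m :
  P m -> P (least P) /\ forall j, P j -> least P <= j.
Proof.
rewrite /least => Pm; case: pselect => [exP|[]]; last by exists m.
by case: ex_minnP.
Qed.

Section TorsionConjugation.
Local Open Scope classical_set_scope.
Local Open Scope group_scope.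
Variables (G H : groupType) (X : choiceType) (act : right_action H X).
Local Notation W := (wreath G act).

Definition period (z : X) (h : H) : nat :=
  least (fun m => (0 < m)%N && (act z (h ^+ m) == z)).

(** The product f(z) f(z h) ... f(z h^(p-1)) over the period p of a finite
    cycle, where f and h are the base and top components of [u]: it is the
    coordinate at z of u^p. *)
Definition cycle_product (u : W) (z : X) : G :=
  wbase (u ^+ period z (wtop u)) z.

Variables (x0 : X) (u : W) (Y : set X) (M : set G).
Hypothesis subM : is_subgroup M.
Let h := wtop u.
Let f := wbase u.
Hypothesis Yfin : forall x, Y x ->
  finite_set (act x @` subgroup_generated [set h]).
Hypothesis Mcycle : forall z, z \in finsupp f -> Y z ->
  exists a, M (cycle_product u z ^ a).

Let periodP x : Y x -> [/\ (0 < period x h)%N, act x (h ^+ period x h) = x &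
  forall j, (0 < j)%N -> act x (h ^+ j) = x -> period x h <= j]%N.
Proof.
move=> /Yfin/cyclic_orbit_finiteP[m xm].
pose P m := (0 < m)%N && (act x (h ^+ m) == x).
have [|/andP[p0 /eqP px] pmin] := @leastP P m.+1.
  by rewrite /P xm eqxx.
by split=> // j j0 xj; apply: pmin; rewrite /P j0 xj eqxx.
Qed.

(* The support points on the cycle of x.  This set depends only on the cycle,
   so that a choice of one of its elements is constant along the cycle. *)
Let origins x : set X :=
  [set z | z \in finsupp f /\ Y z /\ exists i, x = act z (h ^+ i)].

Let origins_shift x : Y x -> origins (act x h) = origins x.
Proof.
move=> Yx; apply/seteqP.
split=> z [fz [Yz [i xz]]]; do 2!split=> //; last first.
  by exists i.+1; rewrite xz -ractM -expgSr.
have [p0 pz _] := periodP Yz; exists ((period z h).-1 + i)%N.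
apply: (@ract_inj _ _ act h).
by rewrite -ractM -expgSr -addSn prednK // expgnDr ractM pz.
Qed.

(** On each cycle of h that meets the support of f, choose a support point z,
    and let P_i = f(z) ... f(z h^(i-1)) be the partial products, for i below
    the period p.  The base element v with value P_i^-1 a at z h^i conjugates
    [u] to an element with coordinates 1 along the cycle, except at z h^(p-1),
    where the coordinate is the conjugate of the cycle product P_p by a.  It
    is finitely supported because finitely many finite cycles are involved. *)
Lemma conjugate_into_subgroup : exists v, forall x, Y x -> M (wbase (u ^ v) x).
Proof.
have /choice[a Ma] : forall z, exists a,
    z \in finsupp f -> Y z -> M (cycle_product u z ^ a).
  move=> z; have [[fz Yz]|nz] := pselect (z \in finsupp f /\ Y z).
    by have [a] := Mcycle fz Yz; exists a.
  by exists 1 => fz Yz; case: nz.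
pose D : set X := [set x | exists z, origins x z].
have finD : finite_set D.
  pose E := \bigcup_(z in [set` finsupp f] `&` Y)
    (act z @` subgroup_generated [set h]).
  apply: (@sub_finite_set _ _ E) => [x [z [fz [Yz [i ->]]]]|].
    exists z => //; exists (h ^+ i) => //.
    exact: subgroup_generatedX.
  apply: bigcup_finite => [|z [_]]; last exact: Yfin.
  by apply: sub_finite_set (finite_fset (finsupp f)) => z [].
pose origin x := xget x0 (origins x).
pose offset x := least (fun i => x == act (origin x) (h ^+ i)).
pose c x := (wbase (u ^+ offset x) (origin x))^-1 * a (origin x).
pose v : W := Wreath act [fsfun x in fset_set D => c x] 1.
have vE x : wbase v x = if pselect (D x) is left _ then c x else 1.
  rewrite fsfunE in_fset_set //; case: pselect => Dx; first by rewrite mem_set.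
  by rewrite memNset.
exists v => x Yx.
have -> : wbase (u ^ v) x = (wbase v x)^-1 * (f x * wbase v (act x h)).
  by rewrite conjgE !wbaseM wbaseV wtopV invg1 !ract1.
have DS : D (act x h) = D x by rewrite /D /= origins_shift.
rewrite !vE DS; case: pselect => [[z0 oz0]|nD]; last first.
  rewrite invg1 mul1g mulg1 (_ : f x = 1); first exact: subg1.
  apply: fsfun_dflt; apply/negP => fx; apply: nD; exists x; split=> //.
  by split=> //; exists 0%N; rewrite expg0 ract1.
rewrite /c /offset /origin origins_shift //.
(* The offset i of x from z is below the period p, and the offset j of x h is
   i + 1, or 0 when i + 1 = p. *)
have := @xgetI _ x0 (origins x) z0 oz0; set z := xget _ _.
move=> [fz [Yz [i0 /eqP xz]]]; have [p0 pz pmin] := periodP Yz.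
have [/eqP xi imin] := @leastP (fun i => x == act z (h ^+ i)) i0 xz.
move: imin xi; set i := least _ => imin xi.
have xhi : act x h = act z (h ^+ i.+1) by rewrite xi -ractM -expgSr.
have [/eqP xhj jmin] :=
  @leastP (fun i => act x h == act z (h ^+ i)) i.+1 (introT eqP xhi).
move: jmin xhj; set j := least _ => jmin xhj.
have uS : wbase (u ^+ i.+1) z = wbase (u ^+ i) z * f x by rewrite wbaseXS -xi.
have cE k : ((wbase (u ^+ i) z)^-1 * a z)^-1 *
      (f x * ((wbase (u ^+ k) z)^-1 * a z)) =
    (a z)^-1 * (wbase (u ^+ i.+1) z * (wbase (u ^+ k) z)^-1 * a z).
  by rewrite invgM invgK uS !mulgA.
rewrite cE; case jE : j => [|j'].
  suff -> : i.+1 = period z h by rewrite wbase1 invg1 mulg1 -conjgE; apply: Ma.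
  apply/eqP; rewrite eqn_leq; apply/andP; split; last first.
    by apply: pmin; rewrite // -xhi xhj jE expg0 ract1.
  rewrite ltnNge; apply/negP => lepi.
  have /imin : x == act z (h ^+ (i - period z h)).
    by rewrite xi -[in X in X == _](subnKC lepi) expgnDr ractM pz.
  lia.
suff -> : j'.+1 = i.+1 by rewrite mulgV mul1g mulVg; apply: subg1.
apply/eqP; rewrite eqn_leq -{1}jE jmin ?xhi //= ltnS; apply: imin.
by apply/eqP/(@ract_inj _ _ act h); rewrite xhj jE -ractM -expgSr.
Qed.
End TorsionConjugation.

(** * The criterion for a wreath product *)

Section WreathCriterion.
Local Open Scope classical_set_scope.
Local Open Scope group_scope.
Variables (G H : groupType) (X : choiceType) (act : right_action H X).
Local Notation W := (wreath G act).
Local Notation base := (@wreath_base G H X act).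
Local Notation top := (@wreath_top G H X act).

(** If a subgroup [M] of [G] meets the classes of the cycle products, then the
    elements of W whose coordinates on the orbit of y all lie in [M] form a
    subgroup that meets the class of every element of [S]. *)
Lemma invariably_generates_cycle_products (S : set W) (y : X) :
  invariably_generates S ->
  (forall x, range (act y) x -> forall h : H,
     finite_set (act x @` subgroup_generated [set h])) ->
  invariably_generates
    (\bigcup_(s in S) (cycle_product s @` [set` finsupp (wbase s)])).
Proof.
move=> /invariably_generatesP genS Yfin.
apply/invariably_generatesP => M subM SM g.
have Yh x h : range (act y) x -> range (act y) (act x h).
  by move=> [k _ <-]; exists (k * h) => //; rewrite ractM.
pose L : set W := [set w | forall x, range (act y) x -> M (wbase w x)].
have Yy : range (act y) y by exists 1; rewrite ?ract1.
have Lfull : forall w, L w.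
  apply: genS => [|s Ss].
    split=> [x _|u v Lu Lv x Yx|u Lu x Yx]; rewrite ?wbase1 ?wbaseM ?wbaseV.
    - exact: (subg1 subM).
    - by apply: (subgM subM); [apply: Lu|apply/Lv/Yh].
    - by apply: (subgV subM); apply/Lu/Yh.
  apply: (conjugate_into_subgroup y subM) => [x Yx|z sz Yz].
  - exact: Yfin.
  - by apply: SM; exists s => //; exists z.
by have := Lfull (base y g) y Yy; rewrite wreath_baseE eqxx.
Qed.

Lemma torsion_type_bottom_FIG : torsion_type act -> FIG W -> FIG G.
Proof.
move=> [y Yfin] [S [finS genS]].
exists (\bigcup_(s in S) (cycle_product s @` [set` finsupp (wbase s)])); split.
  by apply: bigcup_finite => // s _; apply/finite_image/finite_fset.
exact: invariably_generates_cycle_products Yfin.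
Qed.

Lemma torsion_type_bottom_invariably_generated :
  torsion_type act -> invariably_generated W -> invariably_generated G.
Proof.
move=> [y Yfin] [S genS].
by eexists; apply: invariably_generates_cycle_products genS Yfin.
Qed.

Lemma top_FIG : FIG W -> FIG H.
Proof.
move=> [S [finS genS]]; exists (@wtop G H X act @` S).
split; first exact: finite_image.
exact: (invariably_generates_image (@wtopM _ _ _ act) (@wtop_surj _ _ _ act)).
Qed.

Lemma top_invariably_generated :
  invariably_generated W -> invariably_generated H.
Proof.
move=> [S genS]; exists (@wtop G H X act @` S).
exact: (invariably_generates_image (@wtopM _ _ _ act) (@wtop_surj _ _ _ act)).
Qed.

Lemma not_torsion_type_choice : ~ torsion_type act ->
  exists q : X -> X * H, forall x,
    range (act (q x).1) x /\ forall m, act (q x).1 ((q x).2 ^+ m.+1) <> (q x).1.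
Proof.
move=> ntors; suff /choice[q qP] : forall x, exists p : X * H,
    range (act p.1) x /\ forall m, act p.1 (p.2 ^+ m.+1) <> p.1 by exists q.
move=> x; apply: contrapT => nox; apply: ntors; exists x => z [k _ xz] h.
apply: (cyclic_orbit_finiteP _ _ _).2; apply: contrapT => noper.
apply: nox; exists (z, h); split=> /=.
  by exists k^-1; rewrite // -xz ractK.
by move=> m zm; apply: noper; exists m.
Qed.

Lemma FIG_wreath :
  FIG W <-> [/\ finitely_generated W, FIG H & torsion_type act -> FIG G].
Proof.
split=> [figW|[fgW [T [finT genT]] figG]].
  split; first exact: FIG_finitely_generated.
    exact: top_FIG.
  by move=> /torsion_type_bottom_FIG; apply.
have [Z [finZ Zorb]] := finitely_generated_wreath_orbits fgW.
have [/figG[A [finA genA]]|/not_torsion_type_choice[q qP]] :=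
  pselect (torsion_type act).
  exists (top @` T `|` [set base z g | z in Z & g in A]); split.
    by rewrite finite_setU; split; [apply: finite_image|apply: finite_image2].
  exact: invariably_generates_wreath.
have qorb x (g : G) : g <> 1 -> exists2 p, (q @` Z) p & range (act p.1) x.
  move=> /(Zorb x)[z Zz [h _ <-]]; exists (q z); first by exists z.
  by have [[k _ kz] _] := qP z; exists (k * h) => //; rewrite ractM kz.
have [A [finA genA]] : exists A, finite_set A /\
    (q @` Z !=set0 -> subgroup_generated A = [set: G]).
  have [[x _]|noX] := pselect (exists x : X, True).
    have [A [finA genA]] := finitely_generated_wreath_bottom x fgW.
    by exists A.
  by exists set0; split=> // -[_ [x _ _]]; case: noX; exists x.
eexists; split; last first.
  apply: (invariably_generates_wreath_infinite genT genA qorb) => _ [z _ <-].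
  by have [] := qP z.
have finQ : finite_set (q @` Z) by exact: finite_image.
rewrite !finite_setU; split; last exact: finite_image2.
split; last exact: finite_image2.
by apply: finite_image; rewrite finite_setU; split=> //; apply: finite_image.
Qed.

Lemma invariably_generated_wreath :
  invariably_generated W <->
  invariably_generated H /\ (torsion_type act -> invariably_generated G).
Proof.
split=> [igW|[[T genT] igG]].
  split; first exact: top_invariably_generated.
  by move=> /torsion_type_bottom_invariably_generated; apply.
have [/igG[A genA]|/not_torsion_type_choice[q qP]] :=
  pselect (torsion_type act).
  exists (top @` T `|` [set base z g | z in [set: X] & g in A]).
  apply: invariably_generates_wreath => // x g _.
  by exists x => //; exists 1; rewrite ?ract1.
eexists.
apply: (@invariably_generates_wreath_infinite _ _ _ act T [set: G] (range q)).
- by [].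
- move=> _; apply/seteqP; split=> // g _; exact: subgroup_generated_sub.
- move=> x g _; exists (q x); first by exists x.
  by have [] := qP x.
- by move=> _ [z _ <-]; have [] := qP z.
Qed.
End WreathCriterion.

(** * Iterated wreath products *)

Section IteratedWreath.
Variables (G : nat -> groupType) (X : nat -> choiceType).
Variable act : forall i, right_action (G i) (X i).
Local Notation iter_wr := (iterated_wreath act).

Lemma last_non_torsion_bounds n k :
  0 < n -> last_non_torsion act n k -> 1 <= k <= n.
Proof. by move=> n0 [[-> _]|[/andP[/ltnW-> ->]]]. Qed.

Lemma last_non_torsionS m k : last_non_torsion act m.+2 k ->
  [/\ torsion_type (act m.+2), last_non_torsion act m.+1 k & k <= m.+1] \/
  ~ torsion_type (act m.+2) /\ k = m.+2.
Proof.
move=> [[-> tors]|[/andP[k2 km] ntors tors]].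
  left; split=> //; first by apply: tors; lia.
  by left; split=> // i im; apply: tors; lia.
move: km; rewrite leq_eqVlt => /orP[/eqP km|km]; first by right; rewrite -km.
left; split=> //; first by apply: tors; lia.
right; split=> [|//|i im]; first by lia.
by apply: tors; lia.
Qed.

(** While the last action is of torsion-type, the criterion passes the
    condition on to the bottom group, which is the previous iterated product;
    the descent stops at the first action from the right that is not of
    torsion-type. *)
Lemma FIG_iterated_wreath n k : 0 < n -> last_non_torsion act n k ->
  (FIG (iter_wr n) <->
   finitely_generated (iter_wr n) /\ forall i, k <= i <= n -> FIG (G i)).
Proof.
case: n => // m _; elim: m k => [|m IHm] k.
  move=> /(last_non_torsion_bounds (ltn0Sn 0)) k1; have -> : k = 1 by lia.
  split=> [fig1|[_ figG]]; last exact: figG.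
  split=> [|i i1]; first exact: FIG_finitely_generated.
  by have -> : i = 1 by lia.
rewrite [iter_wr m.+2]/=; set V := iter_wr m.+1.
move=> /last_non_torsionS[[tors lastk km]|[ntors ->]].
  split=> [/FIG_wreath[fgW figm /(_ tors)/(IHm k lastk)[_ figG]]|[fgW figG]].
    split=> // i /andP[ki]; rewrite leq_eqVlt ltnS => /orP[/eqP->//|im].
    by apply: figG; rewrite ki.
  apply/FIG_wreath; split=> // [|_]; first by apply: figG; rewrite leqnn leqW.
  apply/(IHm k lastk); split=> [|i /andP[ki im]]; last by apply: figG; lia.
  by case: tors => y _; apply: finitely_generated_wreath_bottom fgW.
split=> [/FIG_wreath[fgW figm _]|[fgW figG]].
  by split=> // i im; have -> : i = m.+2 by lia.
by apply/FIG_wreath; split=> //; apply: figG; rewrite leqnn.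
Qed.

Lemma invariably_generated_iterated_wreath n k :
  0 < n -> last_non_torsion act n k ->
  (invariably_generated (iter_wr n) <->
   forall i, k <= i <= n -> invariably_generated (G i)).
Proof.
case: n => // m _; elim: m k => [|m IHm] k.
  move=> /(last_non_torsion_bounds (ltn0Sn 0)) k1; have -> : k = 1 by lia.
  split=> [ig1 i i1|igG]; last exact: igG.
  by have -> : i = 1 by lia.
rewrite [iter_wr m.+2]/=; set V := iter_wr m.+1.
move=> /last_non_torsionS[[tors lastk km]|[ntors ->]].
  split=> [/invariably_generated_wreath[igm /(_ tors)/(IHm k lastk) igG] i|igG].
    move=> /andP[ki]; rewrite leq_eqVlt ltnS => /orP[/eqP->//|im].
    by apply: igG; rewrite ki.
  apply/invariably_generated_wreath; split=> [|_].
    by apply: igG; rewrite leqnn leqW.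
  by apply/(IHm k lastk) => i /andP[ki im]; apply: igG; lia.
split=> [/invariably_generated_wreath[igm _] i im|igG].
  by have -> : i = m.+2 by lia.
by apply/invariably_generated_wreath; split=> //; apply: igG; rewrite leqnn.
Qed.
End IteratedWreath.

Lemma finitely_generated_regular_wreath (G : nat -> groupType) n : 0 < n ->
  (finitely_generated (regular_wreath G n) <->
   forall i, 1 <= i <= n -> finitely_generated (G i)).
Proof.
case: n => // m _; elim: m => [|m IHm].
  split=> [fg1 i i1|fgG]; last exact: (fgG 1).
  by have -> : i = 1 by lia.
rewrite /regular_wreath [iterated_wreath _ m.+2]/= -/(regular_wreath G m.+1).
split=> [fgW i /andP[i1]|fgG].
  rewrite leq_eqVlt ltnS => /orP[/eqP->|im].
    exact: finitely_generated_image (@wtopM _ _ _ _) (@wtop_surj _ _ _ _) fgW.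
  have fgV := finitely_generated_wreath_bottom (1%g : G m.+2) fgW.
  by apply: (IHm.1 fgV); rewrite i1.
(* The regular action is transitive. *)
apply: (finitely_generated_wreath (Z := [set 1%g]%classic)).
- exact: finite_set1.
- by move=> x g _; exists 1%g => //; exists x => //=; rewrite mul1g.
- by apply/IHm => i /andP[i1 im]; apply: fgG; lia.
- by apply: fgG; rewrite leqnn.
Qed.

Theorem corollaryB (n : nat) (n_gt0 : 0 < n) (G : nat -> groupType)
    (G_nontrivial : forall i, 1 <= i <= n -> nontrivial (G i)) :
  (forall (X : nat -> choiceType) (act : forall i, right_action (G i) (X i)),
    (forall i, 2 <= i <= n -> faithful_action (act i)) ->
    forall k, last_non_torsion act n k ->
      (FIG (iterated_wreath act n) <->
         finitely_generated (iterated_wreath act n) /\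
         (forall i, k <= i <= n -> FIG (G i)))
      /\
      (IG (iterated_wreath act n) <->
         (forall i, k <= i <= n -> IG (G i) \/ FIG (G i)) /\
         ~ (finitely_generated (iterated_wreath act n) /\
            (forall i, k <= i <= n -> FIG (G i)))))
  /\
  (forall k, last_non_torsion (fun i => regular_action (G i)) n k ->
     (FIG (regular_wreath G n) <->
        (forall i, 1 <= i < k -> finitely_generated (G i)) /\
        (forall i, k <= i <= n -> FIG (G i)))).
Proof.

split=> [X act _ k lastk|k lastk].
  split; first exact: FIG_iterated_wreath.
  rewrite -(FIG_iterated_wreath n_gt0 lastk).
  split=> [[igW nfig]|[igG nfig]]; split=> //.
    move=> i ik; apply/IG_or_FIG; move: i ik.
    by apply/(invariably_generated_iterated_wreath n_gt0 lastk).
  apply/(invariably_generated_iterated_wreath n_gt0 lastk) => i ik.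
  exact/IG_or_FIG/igG.
have /andP[k1 kn] := last_non_torsion_bounds n_gt0 lastk.
rewrite (FIG_iterated_wreath n_gt0 lastk) -/(regular_wreath G n).
rewrite finitely_generated_regular_wreath //.
split=> -[fgG figG]; split=> // i /andP[i1 ik].
  by apply: fgG; rewrite i1 (leq_trans (ltnW ik)).
have [ki|ik'] := leqP k i; last by apply: fgG; rewrite i1.
by apply: FIG_finitely_generated; apply: figG; rewrite ki.
Qed.
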